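(* Let $P\subset\mathbb{R}^d$ be a polytope and $Z=Z(Q,\mu)\in\mathcal{Z}_n(\mathbb{R}^d)$ be such that (1) $Z$ is a general position zonotope, and (2) each vertex of $P$ is Hausdorff stable relative to $Z$ and each vertex of $Z$ is Hausdorff stable relative to $P$. Let $d_P(Z)$ be achieved at the $k$ distinct pairs of points $(p_1,q_1),\dots,(p_k,q_k)\in P\times Z$, let $e_i=\mathrm{Lift}(q_i)$, and let $$\mathcal{C}(P,Z)=\{(\Delta Q,\Delta\mu)\in\mathbb{R}^{d\times n}\times\mathbb{R}^d \mid \langle \Delta Q\,e_i+\Delta\mu,\ p_i-q_i\rangle\ge 0\ \ \forall i\}.$$ Suppose that each $q_i$ is a vertex of $Z$ (equivalently, the smallest face of $Z$ containing $q_i$ has dimension $0$). Then $\mathcal{C}(P,Z)$ has empty interior if and only if $Z$ is a local minimum of $d_P$.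
   Context: For a matrix $Q\in\mathbb{R}^{d\times n}$ with columns $g_1,\dots,g_n$ (the generators) and $\mu\in\mathbb{R}^d$, let $A(x)=Qx+\mu$, $I^n=[0,1]^n$, and let $Z(Q,\mu)=A(I^n)$ be the associated zonotope. $\mathcal{Z}_n(\mathbb{R}^d)$ is the quotient of the space of pairs $(Q,\mu)\in\mathbb{R}^{d\times n}\times\mathbb{R}^d$ by the action of $S_n$ permuting the columns of $Q$. A zonotope is a general position zonotope if its generators are in general position (any subset of at most $d$ of them is linearly independent). For such $Z$, each $q\in\partial Z$ has a unique preimage $\mathrm{Lift}(q)\in A^{-1}(q)\cap I^n$. $d(P,Z)=\max(\sup_{p\in P}d(p,Z),\sup_{z\in Z}d(z,P))$ is the Hausdorff distance (Euclidean norm), and $d_P:\mathcal{Z}_n(\mathbb{R}^d)\to\mathbb{R}$, $d_P(Z)=d(P,Z)$. $\Pi(x,W)$ is the Euclidean nearest point to $x$ in $W$. A pair $(p,q)\in P\times Z$ achieves the Hausdorff distance if $\|p-q\|_2=d(P,Z)$ and either $p$ is a vertex of $P$ and $q=\Pi(p,Z)$, or $q$ is a vertex of $Z$ and $p=\Pi(q,P)$; $(p_1,q_1),\dots,(p_k,q_k)$ are all such pairs. For a polytope $X\subset\mathbb{R}^d$, a point $x\notin X^\circ$ (the interior) is Hausdorff stable relative to $X$ if $x-\Pi(x,X)$ lies in the relative interior of the normal cone to $X$ at $\Pi(x,X)$; every point $x\in X^\circ$ is also Hausdorff stable relative to $X$. *)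

(* Defs.v *)
From HB Require Import structures.
From mathcomp Require Import all_fingroup.
From mathcomp Require Import all_boot all_order all_algebra.
From mathcomp Require Import all_classical all_reals all_analysis.

Set Implicit Arguments.
Unset Strict Implicit.
Unset Printing Implicit Defensive.

Import Order.TTheory GRing.Theory Num.Theory.
Import numFieldNormedType.Exports.

Local Open Scope classical_set_scope.
Local Open Scope ring_scope.
Local Open Scope quotient_scope.

(* Points of R^d are column vectors.  The norm carried by matrices in the
   library is the sup norm, hence the explicit Euclidean norm below; the two
   induce the same topology, so open sets, interiors and neighbourhoods are
   those of the library. *)

Section Euclidean.
Variables (R : realType) (d : nat).
Implicit Types (x y : 'cV[R]_d) (X S : set 'cV[R]_d).

Definition dotv x y : R := \sum_(i < d) x i 0 * y i 0.

Definition norm2 x : R := Num.sqrt (dotv x x).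

Definition pt_dist x X : R := inf [set norm2 (x - y) | y in X].

(* The suprema are real-valued; they are meaningful for bounded nonempty sets,
   in particular for polytopes. *)
Definition hausdorff_dist X Y : R :=
  Num.max (sup [set pt_dist x Y | x in X]) (sup [set pt_dist y X | y in Y]).

(* The nearest point of X to x; it exists and is unique when X is a nonempty
   compact convex set, which is the only case used. *)
Definition nearest x X : 'cV[R]_d :=
  xget x [set y | X y /\ forall z, X z -> norm2 (x - y) <= norm2 (x - z)].

Definition conv_hull S : set 'cV[R]_d :=
  [set x | exists (m : nat) (a : 'I_m -> R) (v : 'I_m -> 'cV[R]_d),
     [/\ forall i, S (v i), forall i, 0 <= a i, \sum_i a i = 1
       & x = \sum_i a i *: v i]].

Definition affine_hull S : set 'cV[R]_d :=
  [set x | exists (m : nat) (a : 'I_m -> R) (v : 'I_m -> 'cV[R]_d),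
     [/\ forall i, S (v i), \sum_i a i = 1 & x = \sum_i a i *: v i]].

Definition rel_interior S : set 'cV[R]_d :=
  [set x | S x /\ exists2 e : R, 0 < e &
     forall y, affine_hull S y -> norm2 (y - x) < e -> S y].

Definition polytope X : Prop :=
  exists F, [/\ finite_set F, F !=set0 & X = conv_hull F].

(* The face of X on which the linear functional <c, _> is maximal. *)
Definition face X (c : 'cV[R]_d) : set 'cV[R]_d :=
  [set x | X x /\ forall y, X y -> dotv c y <= dotv c x].

Definition vertex X x : Prop := exists c, face X c = [set x].

Definition normal_cone X x : set 'cV[R]_d :=
  [set c | forall y, X y -> dotv c (y - x) <= 0].

Definition hausdorff_stable x X : Prop :=
  interior X x \/
  ~ interior X x /\
  rel_interior (normal_cone X (nearest x X)) (x - nearest x X).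

Definition achieves_hausdorff X Y x y : Prop :=
  [/\ X x, Y y, norm2 (x - y) = hausdorff_dist X Y
    & vertex X x /\ y = nearest x Y \/ vertex Y y /\ x = nearest y X].

End Euclidean.

Section Zonotopes.
Variables (R : realType) (d n : nat).
Implicit Types (Q : 'M[R]_(d, n)) (mu : 'cV[R]_d).

Definition unit_cube : set 'cV[R]_n := [set x | forall i, 0 <= x i 0 <= 1].

Definition zono_map Q mu (x : 'cV[R]_n) : 'cV[R]_d := Q *m x + mu.

Definition zonotope Q mu : set 'cV[R]_d := zono_map Q mu @` unit_cube.

(* Subsets of generators are subsets of column indices, so that two equal
   columns count as two generators. *)
Definition general_position Q : Prop :=
  forall J : {set 'I_n}, (#|J| <= d)%N -> free [seq col j Q | j in J].

(* The preimage of q in the cube; it is unique for q in the boundary of a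
   general position zonotope. *)
Definition lift_pt Q mu (q : 'cV[R]_d) : 'cV[R]_n :=
  xget 0 [set x | unit_cube x /\ zono_map Q mu x = q].

Definition improving_cone Q mu (k : nat) (p q : 'I_k -> 'cV[R]_d) :
    set ('M[R]_(d, n) * 'cV[R]_d) :=
  [set D | forall i,
     0 <= dotv (D.1 *m lift_pt Q mu (q i) + D.2) (p i - q i)].

Definition col_equiv (x y : 'M[R]_(d, n) * 'cV[R]_d) : bool :=
  [exists s : 'S_n, (col_perm s x.1 == y.1) && (x.2 == y.2)].

Lemma col_equiv_refl : reflexive col_equiv.
Proof. by move=> x; apply/existsP; exists 1%g; rewrite col_perm1 !eqxx. Qed.

Lemma col_equiv_sym : symmetric col_equiv.
Proof.
suff H x y : col_equiv x y -> col_equiv y x by move=> x y; apply/idP/idP; exact: H.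
case/existsP => s /andP[/eqP Exy /eqP E2]; apply/existsP; exists s^-1%g.
by rewrite -Exy -col_permM mulVg col_perm1 E2 !eqxx.
Qed.

Lemma col_equiv_trans : transitive col_equiv.
Proof.
move=> y x z /existsP[s /andP[/eqP E1 /eqP E2]] /existsP[t /andP[/eqP F1 /eqP F2]].
apply/existsP; exists (t * s)%g.
by rewrite col_permM E1 F1 E2 F2 !eqxx.
Qed.

Canonical col_equivRel :=
  EquivRel col_equiv col_equiv_refl col_equiv_sym col_equiv_trans.

(* The space of zonotopes with n generators, with the quotient topology. *)
Definition zono_space := quotient_topology {eq_quot col_equivRel}.


Definition zono_class Q mu : zono_space := \pi_zono_space (Q, mu).

Definition zono_set (z : zono_space) : set 'cV[R]_d :=
  zonotope (generic_quotient.repr z).1 (generic_quotient.repr z).2.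

Lemma zono_set_class Q mu : zono_set (zono_class Q mu) = zonotope Q mu.
Proof.
have sub (x y : 'M[R]_(d, n) * 'cV[R]_d) : col_equiv x y ->
    zonotope x.1 x.2 `<=` zonotope y.1 y.2.
  case/existsP => s /andP[/eqP <- /eqP <-] _ [v v01 <-].
  exists (row_perm s v); first by move=> i; rewrite mxE; exact: v01.
  rewrite /zono_map; congr (_ + _); apply/matrixP => i j; rewrite !mxE.
  by rewrite [RHS](reindex_perm s) /=; apply: eq_bigr => k _; rewrite !mxE.
have /eqmodP E : generic_quotient.repr (zono_class Q mu) = (Q, mu) %[mod {eq_quot col_equivRel}].
  exact: (reprK (zono_class Q mu)).
apply/seteqP; split; first exact: (sub _ _ E).
by apply: (sub (Q, mu)); rewrite col_equiv_sym; exact: E.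
Qed.

Definition dist_to (P : set 'cV[R]_d) (z : zono_space) : R :=
  hausdorff_dist P (zono_set z).

Definition local_min (T : topologicalType) (f : T -> R) (x : T) : Prop :=
  \forall y \near x, f x <= f y.

End Zonotopes.

(* Main.v *)
Require Import Defs.
From mathcomp Require Import all_fingroup.
From mathcomp Require Import all_boot all_order all_algebra.
From mathcomp Require Import all_classical all_reals all_analysis.
From mathcomp Require Import ring lra.

Set Implicit Arguments.
Unset Strict Implicit.
Unset Printing Implicit Defensive.

Import Order.TTheory GRing.Theory Num.Theory.
Import numFieldNormedType.Exports.
Local Open Scope classical_set_scope.
Local Open Scope ring_scope.

(** Write [Z] for the zonotope, [r] for its distance to [P], and let [(Q, mu)]
    move in a direction [D].  The point of [Z] with lift [e] is then displaced
    by [D.1 *m e + D.2], so that its distance to a fixed point [x] decreases at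
    first order exactly when the [gain] of [D], which is the linear form that
    cuts out the cone, is positive.

    Suppose that [D] is interior to the cone.  As [p i != q i], a positive
    distance which stability guarantees ([stable_hausdorff_gt0]: two equal
    polytopes are not stable relative to each other), all gains are positive
    ([interior_improving_cone_gt0]).  The distance to a convex set is a convex
    function, so that the distance between [P] and the moved zonotope is decided
    by finitely many points: the vertices of [P] and the images of the corners of
    the cube.  Those nearer than [r] remain so, and those at distance [r] form
    achieving pairs and come strictly nearer ([perturb_hausdorff_lt]); hence [Z]
    is not a local minimum.  General position is used for the corners: one at
    distance [r] from [P] maximizes a nonzero linear functional over [Z], and the
    generators orthogonal to this functional are linearly independent, so that it
    is a vertex with a single lift ([gp_corner_signed]).

    Suppose instead that the cone has empty interior.  Positivity of all gains
    being an open condition, every displacement has a pair [(x, y)] of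
    nonpositive gain, and this pair alone keeps the distance at least [r]
    ([near_hausdorff_ge]).  If [x] is the nearest point of [P] to [y], the
    half-space through [x] with normal [y - x] contains [P], and [y] does not
    move towards it.  If [y] is the nearest point of [Z] to [x], the half-space
    through [y] with normal [x - y] contains [Z]; because [x] is stable and [y]
    is a vertex, [x - y] is in the interior of the normal cone, so that on nearby
    zonotopes this direction is still maximal at the lift of [y]
    ([near_exposed_lift]), which does not move towards [x].

    Neighbourhoods of the class of [(Q, mu)] correspond to those of [(Q, mu)]
    because the projection is continuous and open ([near_zono_class]). *)

(** * Euclidean inner product and norm *)

Section EuclideanSpace.
Variables (R : realType) (d : nat).
Implicit Types (x y z u v : 'cV[R]_d) (a t r : R).

Lemma dotvC x y : dotv x y = dotv y x.
Proof. by apply: eq_bigr => i _; rewrite mulrC. Qed.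

Lemma dotvDl x y z : dotv (x + y) z = dotv x z + dotv y z.
Proof. by rewrite -big_split; apply: eq_bigr => i _; rewrite mxE mulrDl. Qed.

Lemma dotvZl a x y : dotv (a *: x) y = a * dotv x y.
Proof. by rewrite big_distrr; apply: eq_bigr => i _ /=; rewrite mxE mulrA. Qed.

Lemma dotvNl x y : dotv (- x) y = - dotv x y.
Proof. by rewrite -scaleN1r dotvZl mulN1r. Qed.

Lemma dotvBl x y z : dotv (x - y) z = dotv x z - dotv y z.
Proof. by rewrite dotvDl dotvNl. Qed.

Lemma dotvDr x y z : dotv x (y + z) = dotv x y + dotv x z.
Proof. by rewrite dotvC dotvDl !(dotvC x). Qed.

Lemma dotvZr a x y : dotv x (a *: y) = a * dotv x y.
Proof. by rewrite dotvC dotvZl dotvC. Qed.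

Lemma dotvNr x y : dotv x (- y) = - dotv x y.
Proof. by rewrite dotvC dotvNl dotvC. Qed.

Lemma dotvBr x y z : dotv x (y - z) = dotv x y - dotv x z.
Proof. by rewrite dotvDr dotvNr. Qed.

Lemma dot0v x : dotv 0 x = 0.
Proof. by rewrite -(scale0r 0) dotvZl mul0r. Qed.

Lemma dotv0 x : dotv x 0 = 0.
Proof. by rewrite dotvC dot0v. Qed.

Lemma dotv_suml (I : Type) (s : seq I) (F : I -> 'cV[R]_d) y :
  dotv (\sum_(i <- s) F i) y = \sum_(i <- s) dotv (F i) y.
Proof.
by elim: s => [|i s IH]; rewrite ?big_nil ?dot0v// !big_cons dotvDl IH.
Qed.

Lemma dotv_sumr (I : Type) (s : seq I) (F : I -> 'cV[R]_d) x :
  dotv x (\sum_(i <- s) F i) = \sum_(i <- s) dotv x (F i).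
Proof.
by rewrite dotvC dotv_suml; apply: eq_bigr => i _; rewrite dotvC.
Qed.

Definition dotvE := (dotvDl, dotvDr, dotvNl, dotvNr, dotvZl, dotvZr).

Lemma dotv_ge0 x : 0 <= dotv x x.
Proof. by apply: sumr_ge0 => i _; rewrite -expr2 sqr_ge0. Qed.

Lemma dotv_eq0 x : (dotv x x == 0) = (x == 0).
Proof.
apply/eqP/eqP => [/psumr_eq0P x0|->]; last exact: dot0v.
apply/colP => i; rewrite mxE; apply/eqP; rewrite -sqrf_eq0 expr2.
by rewrite x0// => j _; rewrite -expr2 sqr_ge0.
Qed.

Lemma dotv_gt0 x : (0 < dotv x x) = (x != 0).
Proof. by rewrite lt_def dotv_eq0 dotv_ge0 andbT. Qed.

Lemma norm2_ge0 x : 0 <= norm2 x.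
Proof. exact: sqrtr_ge0. Qed.

Lemma sqr_norm2 x : norm2 x ^+ 2 = dotv x x.
Proof. by rewrite sqr_sqrtr// dotv_ge0. Qed.

Lemma norm2_eq0 x : (norm2 x == 0) = (x == 0).
Proof. by rewrite -sqrf_eq0 sqr_norm2 dotv_eq0. Qed.

Lemma norm20 : norm2 (0 : 'cV[R]_d) = 0.
Proof. by apply/eqP; rewrite norm2_eq0. Qed.

Lemma norm2N x : norm2 (- x) = norm2 x.
Proof. by rewrite /norm2 !dotvE opprK. Qed.

Lemma norm2BC x y : norm2 (x - y) = norm2 (y - x).
Proof. by rewrite -norm2N opprB. Qed.

Lemma norm2_lt x r : 0 < r -> (norm2 x < r) = (dotv x x < r ^+ 2).
Proof. by move=> r0; rewrite -sqr_norm2 ltr_pXn2r ?nnegrE ?norm2_ge0 ?ltW. Qed.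

Lemma norm2_le x y : (norm2 x <= norm2 y) = (dotv x x <= dotv y y).
Proof. by rewrite -!sqr_norm2 ler_pXn2r ?nnegrE ?norm2_ge0. Qed.

Lemma norm2Z a x : norm2 (a *: x) = `|a| * norm2 x.
Proof. by rewrite /norm2 !dotvE mulrA -expr2 sqrtrM ?sqr_ge0// sqrtr_sqr. Qed.

(** Cauchy-Schwarz, from the square norm of the combination of [x] and [y]
    that is orthogonal to [y]. *)
Lemma cauchy_schwarz x y : dotv x y <= norm2 x * norm2 y.
Proof.
have [->|y0] := eqVneq y 0; first by rewrite dotv0 norm20 mulr0.
have yy : 0 < dotv y y by rewrite dotv_gt0.
have := dotv_ge0 (dotv y y *: x - dotv x y *: y).
rewrite !dotvE (dotvC y x) => H.
have {}H : dotv x y ^+ 2 <= dotv x x * dotv y y.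
  rewrite -subr_ge0 -(pmulr_rge0 _ yy).
  by apply: le_trans H _; rewrite le_eqVlt; apply/orP; left; apply/eqP; ring.
apply: le_trans (ler_norm _) _.
rewrite -(ler_pXn2r (ltn0Sn 1)) ?nnegrE ?mulr_ge0 ?norm2_ge0//.
by rewrite real_normK ?num_real// exprMn !sqr_norm2.
Qed.

Lemma norm2D x y : norm2 (x + y) <= norm2 x + norm2 y.
Proof.
rewrite -(ler_pXn2r (ltn0Sn 1)) ?nnegrE ?addr_ge0 ?norm2_ge0//.
rewrite sqrrD !sqr_norm2 !dotvE (dotvC y x).
by have := cauchy_schwarz x y; lra.
Qed.

Lemma norm2_convex_comb m (a : 'I_m -> R) (v : 'I_m -> 'cV[R]_d) r :
  (forall i, 0 <= a i) -> \sum_i a i = 1 -> (forall i, norm2 (v i) <= r) ->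
  norm2 (\sum_i a i *: v i) <= r.
Proof.
move=> a0 a1 vr; apply: (@le_trans _ _ (\sum_i a i * r)); last first.
  by rewrite -mulr_suml a1 mul1r.
elim/big_ind2 : _ => [|x b y c xb yc|i _]; first by rewrite norm20.
  exact: le_trans (norm2D _ _) (lerD xb yc).
by rewrite norm2Z ger0_norm// ler_wpM2l.
Qed.

Lemma dotv_convex_comb_le m (a : 'I_m -> R) (v : 'I_m -> 'cV[R]_d) u r :
  (forall i, 0 <= a i) -> \sum_i a i = 1 -> (forall i, dotv u (v i) <= r) ->
  dotv u (\sum_i a i *: v i) <= r.
Proof.
move=> a0 a1 vr; rewrite dotv_sumr -[leRHS]mul1r -a1 mulr_suml.
by apply: ler_sum => i _; rewrite dotvZr ler_wpM2l.
Qed.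

(** The square of the left-hand side is
    [dotv u u - 2 * t * dotv u v + O(t ^ 2)]. *)
Lemma norm2_move_lt u v r : 0 < r ->
  norm2 u < r \/ norm2 u = r /\ 0 < dotv u v ->
  \forall t \near 0^'+, norm2 (u - t *: v) < r.
Proof.
move=> r0 H.
have sqE t : dotv (u - t *: v) (u - t *: v) =
    dotv u u - t * (2 * dotv u v - t * dotv v v).
  by rewrite !dotvE (dotvC v u); ring.
have cvgt c c' : (fun t : R => c - t * c') @ 0^'+ --> c.
  apply: cvg_at_right_filter.
  rewrite -[X in _ --> X]subr0 -[X in _ --> _ - X](mul0r c').
  by apply: cvgB; [exact: cvg_cst | apply: cvgM; [exact: cvg_id|exact: cvg_cst]].
case: H => [ur|[ur uv]].
  have : (fun t : R => dotv (u - t *: v) (u - t *: v)) @ 0^'+ --> dotv u u.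
    under eq_fun do rewrite sqE.
    apply: cvg_at_right_filter.
    rewrite -[X in _ --> X]subr0.
    rewrite -[X in _ --> _ - X](mul0r (2 * dotv u v - 0 * dotv v v)).
    apply: cvgB; first exact: cvg_cst.
    apply: cvgM; first exact: cvg_id.
    apply: cvgB; first exact: cvg_cst.
    by apply: cvgM; [exact: cvg_id|exact: cvg_cst].
  move=> /cvgr_lt; move: ur; rewrite (norm2_lt _ r0) => ur /(_ _ ur).
  by apply: filterS => t; rewrite norm2_lt.
near=> t; rewrite norm2_lt// sqE -ur sqr_norm2 gtrBl mulr_gt0//.
near: t; apply: cvgr_gt (cvgt _ _) _ _.
by rewrite mulr_gt0.
Unshelve. all: by end_near. Qed.

Lemma dotv_continuous (T : topologicalType) (f g : T -> 'cV[R]_d) :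
  (forall i, continuous (fun s => f s i 0)) ->
  (forall i, continuous (fun s => g s i 0)) ->
  continuous (fun s => dotv (f s) (g s)).
Proof.
move=> fc gc s; apply: cvg_big => [|i _]; first exact: add_continuous.
by apply: cvgM; [exact: fc|exact: gc].
Qed.

Lemma affine_continuous (T : topologicalType) m (f : 'I_m -> T -> R)
    (b : 'I_m -> R) r :
  (forall i, continuous (f i)) ->
  continuous (fun s => r + \sum_i f i s * b i).
Proof.
move=> fc s; apply: cvgD; first exact: cvg_cst.
apply: cvg_big => [|i _]; first exact: add_continuous.
by apply: cvgM; [exact: fc|exact: cvg_cst].
Qed.

Lemma near_continuous_lt (T : topologicalType) (f : T -> R) (s : T) r :
  continuous f -> f s < r -> \forall s' \near s, f s' < r.
Proof. by move=> fc; exact: cvgr_lt (fc s) _. Qed.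

Lemma near_continuous_gt (T : topologicalType) (f : T -> R) (s : T) r :
  continuous f -> r < f s -> \forall s' \near s, r < f s'.
Proof. by move=> fc; exact: cvgr_gt (fc s) _. Qed.

End EuclideanSpace.

(** * Convex hulls of finite sets and nearest points *)

Section ConvexHull.
Variables (R : realType) (d : nat).
Implicit Types (x y z u v : 'cV[R]_d) (X S : set 'cV[R]_d) (s : seq 'cV[R]_d).

Lemma sub_conv_hull S : S `<=` conv_hull S.
Proof.
move=> x Sx; exists 1%N, (fun=> 1), (fun=> x).
by split=> //; rewrite big_ord1 ?scale1r.
Qed.

Lemma conv_hull_mono S X : S `<=` X -> conv_hull S `<=` conv_hull X.
Proof.
move=> SX x [m [a [v [vS a0 a1 ->]]]]; exists m, a, v.
by split=> // i; exact: SX.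
Qed.

Lemma conv_hull_seqP s x : conv_hull [set` s] x <->
  exists a : 'rV[R]_(size s),
    [/\ forall i, 0 <= a 0 i, \sum_i a 0 i = 1 & x = \sum_i a 0 i *: s`_i].
Proof.
split=> [[m [a [v [vs a0 a1 ->]]]]|[a [a0 a1 ->]]]; last first.
  exists (size s), (a 0), (fun i => s`_i); split=> // i.
  by rewrite /= mem_nth.
have ltv i : (index (v i) s < size s)%N by rewrite index_mem; exact: vs.
pose k i := Ordinal (ltv i).
exists (\row_j \sum_(i | k i == j) a i); split=> [j||].
- by rewrite mxE sumr_ge0.
- rewrite -a1 (partition_big k predT)//=.
  by apply: eq_bigr => j _; rewrite mxE.
rewrite (partition_big k predT)//=; apply: eq_bigr => j _.
rewrite mxE scaler_suml; apply: eq_bigr => i /eqP <-.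
by rewrite nth_index//; exact: vs.
Qed.

(** Barycentres of barycentres of a finite family are barycentres of it: the
    coefficients multiply as matrices. *)
Lemma conv_hull_idem s : conv_hull (conv_hull [set` s]) `<=` conv_hull [set` s].
Proof.
move=> x [m [b [v [vs b0 b1 ->]]]].
have /choice[a aP] i := (conv_hull_seqP s (v i)).1 (vs i).
apply/conv_hull_seqP; exists (\row_j \sum_i b i * a i 0 j); split=> [j||].
- by rewrite mxE sumr_ge0// => i _; rewrite mulr_ge0//; case: (aP i).
- under eq_bigr do rewrite mxE.
  rewrite exchange_big /= -[RHS]b1; apply: eq_bigr => i _.
  by rewrite -mulr_sumr; case: (aP i) => _ -> _; rewrite mulr1.
under [RHS]eq_bigr do rewrite mxE scaler_suml.
rewrite exchange_big /=; apply: eq_bigr => i _.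
case: (aP i) => _ _ {1}->; rewrite scaler_sumr.
by apply: eq_bigr => j _; rewrite scalerA.
Qed.

Lemma convex_segment X x y t : conv_hull X `<=` X -> X x -> X y ->
  0 <= t -> t <= 1 -> X (x + t *: (y - x)).
Proof.
move=> cX Xx Xy t0 t1; apply: cX.
exists 2%N, (fun i : 'I_2 => if i == 0 then 1 - t else t),
  (fun i : 'I_2 => if i == 0 then x else y).
split=> [i|i||]; rewrite ?big_ord_recr ?big_ord0 /=; do ?case: ifP => //.
- by rewrite subr_ge0.
- by rewrite add0r subrK.
by rewrite add0r scalerBl scalerBr scale1r addrA addrAC.
Qed.

Lemma polytope_seqP X :
  polytope X <-> exists s, s != [::] /\ X = conv_hull [set` s].
Proof.
split=> [[F [/finite_seqP[s ->] [x xs] ->]]|[s [s0 ->]]].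
  by exists s; split=> //; apply: contraPN xs => /eqP ->.
exists [set` s]; split=> //.
by case: s s0 => // x s _; exists x; rewrite /= mem_head.
Qed.

Lemma polytope_convex X : polytope X -> conv_hull X `<=` X.
Proof. by move=> /polytope_seqP[s [_ ->]]; exact: conv_hull_idem. Qed.

Lemma polytope_nonempty X : polytope X -> X !=set0.
Proof. by move=> [F [_ [x Fx] ->]]; exists x; exact: sub_conv_hull. Qed.

Lemma polytope_bounded X : polytope X -> exists M, forall x, X x -> norm2 x <= M.
Proof.
move=> /polytope_seqP[s [_ ->]]; exists (\sum_(y <- s) norm2 y) => x.
move=> [m [a [v [vs a0 a1 ->]]]]; apply: norm2_convex_comb => // i.
have := vs i; rewrite /= => vi; rewrite (big_rem _ vi) /= lerDl.
by rewrite sumr_ge0// => y _; exact: norm2_ge0.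
Qed.

(** The hull of a finite family is the image of a simplex of coefficients,
    which is compact, so the distance to [x] attains its minimum. *)
Lemma polytope_proximinal X x : polytope X ->
  exists y, X y /\ forall z, X z -> norm2 (x - y) <= norm2 (x - z).
Proof.
move=> pX; have [x0 Xx0] := polytope_nonempty pX.
move/polytope_seqP: pX => [s [s0 XE]]; set m := size s.
pose A : set 'rV[R]_m := [set a | forall i, `[0, 1]%classic (a 0 i)].
pose B : set 'rV[R]_m := [set a | \sum_i a 0 i = 1].
pose f (a : 'rV[R]_m) := dotv (x - \sum_i a 0 i *: s`_i) (x - \sum_i a 0 i *: s`_i).
have sE (a : 'rV[R]_m) : (A `&` B) a <->
    (forall i, 0 <= a 0 i) /\ \sum_i a 0 i = 1.
  split=> [[Aa Ba]|[a0 a1]].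
    by split=> // i; have := Aa i; rewrite /= in_itv /= => /andP[].
  split=> // i; rewrite /= in_itv /= a0 -a1 (bigD1 i)//= lerDl.
  by rewrite sumr_ge0.
have cA : compact A.
  by apply: (@rV_compact R m (fun=> `[0, 1]%classic)) => i; exact: segment_compact.
have cB : closed B.
  apply: (@preimage_closed _ _ (fun a : 'rV[R]_m => \sum_i a 0 i) [set r | r = 1]);
    last exact: closed_eq.
  move=> a _; apply: continuous_big => [|i _]; first exact: add_continuous.
  exact: coord_continuous.
have cf : continuous f.
  suff c j : continuous (fun a : 'rV[R]_m => (x - \sum_i a 0 i *: s`_i) j 0).
    exact: (dotv_continuous (f := fun a : 'rV[R]_m => x - \sum_i a 0 i *: s`_i) c c).
  rewrite (_ : (fun a => _) = fun a : 'rV[R]_m => x j 0 + \sum_i a 0 i * - s`_i j 0).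
    by apply: affine_continuous => i; exact: coord_continuous.
  apply/funext => a; rewrite !mxE summxE -sumrN; congr (_ + _).
  by apply: eq_bigr => i _; rewrite mxE mulrN.
have [||a] := @compact_EVT_min _ _ f (A `&` B) _ (compact_closedI cA cB).
- move: Xx0; rewrite XE => /conv_hull_seqP[a [a0 a1 _]].
  by exists a; exact/sE.
- exact: continuous_subspaceT.
rewrite inE => /sE[a0 a1] amin.
exists (\sum_i a 0 i *: s`_i); rewrite XE; split.
  by apply/conv_hull_seqP; exists a.
move=> z /conv_hull_seqP[b [b0 b1 ->]]; rewrite norm2_le.
by apply: amin; rewrite inE; exact/sE.
Qed.

Lemma nearest_in X x : polytope X -> X (nearest x X).
Proof. by by move=> /(polytope_proximinal x)/(xgetPex x)[]. Qed.

Lemma nearest_le X x z : polytope X -> X z -> norm2 (x - nearest x X) <= norm2 (x - z).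
Proof. by by move=> /(polytope_proximinal x)/(xgetPex x)[_]; apply. Qed.

Lemma nearest_id X x : polytope X -> X x -> nearest x X = x.
Proof.
move=> pX Xx; have := nearest_le x pX Xx.
rewrite subrr norm20 => H; apply/eqP; rewrite eq_sym -subr_eq0 -norm2_eq0.
by rewrite eq_le H norm2_ge0.
Qed.

(** Moving from the nearest point towards [z] cannot decrease the distance to
    [x]; the inequality is the derivative of that statement. *)
Lemma nearest_obtuse X x z : polytope X -> X z ->
  dotv (x - nearest x X) (z - nearest x X) <= 0.
Proof.
move=> pX Xz; set y := nearest x X; rewrite leNgt; apply/negP => H.
have Xy : X y := nearest_in x pX.
set u := x - y in H *; set v := z - y in H *.
have v0 : 0 < dotv v v.
  by rewrite dotv_gt0; apply: contraTneq H => ->; rewrite dotv0 ltxx.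
(* The squared distance from [x] to [y + t *: v] is smallest at this quotient. *)
pose t := Num.min 1 (dotv u v / dotv v v).
have t0 : 0 < t by rewrite lt_min ltr01 divr_gt0.
have t1 : t <= 1 by rewrite ge_min lexx.
have tv : t * dotv v v <= dotv u v.
  by rewrite -ler_pdivlMr// ge_min lexx orbT.
have := nearest_le x pX (convex_segment (polytope_convex pX) Xy Xz (ltW t0) t1).
rewrite -/y -/v opprD addrA -/u norm2_le.
clearbody u v; rewrite !dotvE (dotvC v u).
have : 0 < t * dotv u v by rewrite mulr_gt0.
have : t * (t * dotv v v) <= t * dotv u v by rewrite ler_wpM2l// ltW.
lra.
Qed.

(** A point [v] of a finite set that is outside the hull of the others is
    exposed by the direction from its projection on this hull to [v]. *)
Lemma separated_vertex s v : v \in s ->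
  ~ conv_hull [set` [seq x <- s | x != v]] v -> vertex (conv_hull [set` s]) v.
Proof.
set s' := [seq x <- s | x != v] => vs nv.
have [s'0|s'0] := eqVneq s' [::].
  have sv y : y \in s -> y = v.
    move=> ys; apply/eqP; apply: contraT => yv.
    by have : y \in s' by [rewrite mem_filter yv]; rewrite s'0.
  exists 0; apply/seteqP; split=> y /=.
    case=> -[m [a [w [ws a0 a1 ->]]]] _.
    rewrite (eq_bigr (fun i => a i *: v)) => [|i _].
      by rewrite -scaler_suml a1 scale1r.
    by rewrite (sv (w i))//; exact: ws.
  move=> ->; split; first exact: sub_conv_hull.
  by move=> z _; rewrite !dot0v.
have pX' : polytope (conv_hull [set` s']) by apply/polytope_seqP; exists s'.
set y := nearest v (conv_hull [set` s']).
have yin : conv_hull [set` s'] y := nearest_in v pX'.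
have c0 : 0 < dotv (v - y) (v - y).
  by rewrite dotv_gt0 subr_eq0; apply: contra_notN nv => /eqP ->.
have cs z : z \in s -> z != v -> dotv (v - y) z < dotv (v - y) v.
  move=> zs zv; have : conv_hull [set` s'] z.
    by apply: sub_conv_hull; rewrite /= mem_filter zv.
  move=> /(nearest_obtuse v pX'); rewrite -/y.
  by move: c0; rewrite !dotvBr; lra.
have cs' z : z \in s -> dotv (v - y) z <= dotv (v - y) v.
  by move=> zs; have [->//|zv] := eqVneq z v; exact: ltW (cs z zs zv).
exists (v - y); apply/seteqP.
split=> [x [[m [a [w [ws a0 a1 ->]]]] xmax]|x ->]; last first.
  split; first exact: sub_conv_hull.
  move=> z [m [a [w [ws a0 a1 ->]]]].
  by apply: dotv_convex_comb_le => // i; exact/cs'/ws.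
(* All the weight of a maximizer is on [v]. *)
have {xmax} := xmax v (sub_conv_hull vs).
rewrite dotv_sumr -[leLHS]mul1r -a1 mulr_suml -subr_ge0 -sumrB => H.
have /eqP : \sum_i a i * (dotv (v - y) v - dotv (v - y) (w i)) = 0.
  apply/eqP; rewrite eq_le; apply/andP; split.
    rewrite -oppr_ge0 -sumrN; apply: le_trans H _; apply: ler_sum => i _.
    by rewrite dotvZr mulrBr opprB.
  by apply: sumr_ge0 => i _; rewrite mulr_ge0// subr_ge0; exact/cs'/ws.
rewrite psumr_eq0 => [/allP H0|i _]; last by rewrite mulr_ge0// subr_ge0; exact/cs'/ws.
rewrite (eq_bigr (fun i => a i *: v)) => [|i _].
  by rewrite -scaler_suml a1 scale1r.
have := H0 i (mem_index_enum i); rewrite /= mulf_eq0 => /orP[/eqP ->|].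
  by rewrite !scale0r.
have [->//|wv] := eqVneq (w i) v.
by rewrite subr_eq0 gt_eqF//; exact: cs (ws i) wv.
Qed.

Lemma polytope_vertices X : polytope X ->
  exists s, [/\ s != [::], X = conv_hull [set` s] & forall v, v \in s -> vertex X v].
Proof.
move=> pX; have [x Xx] := polytope_nonempty pX.
move/polytope_seqP: pX => [s [_ XE]].
have [k ks] := ubnP (size s); elim: k => // k IH in s ks XE *.
have [sV|/existsNP[v /not_implyP[vs nv]]] := pselect (forall v, v \in s -> vertex X v).
  exists s; split=> //; apply: contraPneq Xx => s0.
  rewrite XE s0 => -[[|m] [a [w [ws _ a1 _]]]]; last by have := ws 0.
  by move: a1; rewrite big_ord0 => /esym/eqP; rewrite oner_eq0.
apply: (IH [seq y <- s | y != v]).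
  rewrite size_filter -ltnS; apply: leq_trans ks; rewrite ltnS.
  rewrite -(count_predC (fun y => y != v) s).
  by rewrite -addn1 leq_add2l -has_count; apply/hasP; exists v => //=; rewrite eqxx.
have vh : conv_hull [set` [seq y <- s | y != v]] v.
  by apply: contrapT => /(separated_vertex vs); rewrite -XE.
rewrite XE; apply/seteqP; split; last first.
  by apply: conv_hull_mono => y /=; rewrite mem_filter => /andP[].
apply: subset_trans (@conv_hull_idem _); apply: conv_hull_mono => y /= ys.
have [->//|yv] := eqVneq y v; apply: sub_conv_hull.
by rewrite /= mem_filter yv.
Qed.

End ConvexHull.

(** * Distance to a polytope and Hausdorff distance *)

Section HausdorffDistance.
Variables (R : realType) (d : nat).
Implicit Types (x y z u v c q : 'cV[R]_d) (X Y : set 'cV[R]_d) (r : R).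

Lemma pt_dist_le X x y : X y -> pt_dist x X <= norm2 (x - y).
Proof.
move=> Xy; apply: ge_inf; last by exists y.
by exists 0 => _ [z _ <-]; exact: norm2_ge0.
Qed.

Lemma pt_dist_ge X x r : X !=set0 -> (forall z, X z -> r <= norm2 (x - z)) ->
  r <= pt_dist x X.
Proof.
move=> [y Xy] H; apply: lb_le_inf; first by exists (norm2 (x - y)), y.
by move=> _ [z Xz <-]; exact: H.
Qed.

Lemma pt_dist_nearest X x : polytope X -> pt_dist x X = norm2 (x - nearest x X).
Proof.
move=> pX; apply/eqP; rewrite eq_le pt_dist_le /=; last exact: nearest_in.
by apply: pt_dist_ge (polytope_nonempty pX) _ => z; exact: nearest_le.
Qed.

(** A half-space with normal [u], at distance [norm2 u] from [x], separates
    [x] from [X]. *)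
Lemma pt_dist_ge_halfspace X x u : X !=set0 ->
  (forall z, X z -> dotv u u <= dotv u (x - z)) -> norm2 u <= pt_dist x X.
Proof.
move=> X0 H; apply: pt_dist_ge => // z /H {}H.
have [u0|u0] := eqVneq (norm2 u) 0; first by rewrite u0 norm2_ge0.
rewrite -(@ler_pM2l _ (norm2 u)) ?lt_def ?u0 ?norm2_ge0//.
rewrite -expr2 sqr_norm2; exact: le_trans H (cauchy_schwarz _ _).
Qed.

(** The barycentre of the nearest points of some points of [X] belongs to [Y]
    and is close enough to the barycentre of these points. *)
Lemma pt_dist_conv_hull_le X Y r x : polytope Y ->
  (forall y, X y -> pt_dist y Y <= r) -> conv_hull X x -> pt_dist x Y <= r.
Proof.
move=> pY Xr [m [a [v [vX a0 a1 ->]]]].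
have Yn : Y (\sum_i a i *: nearest (v i) Y).
  apply: (polytope_convex pY); exists m, a, (fun i => nearest (v i) Y).
  by split=> // i; exact: nearest_in.
apply: le_trans (pt_dist_le _ Yn) _.
rewrite -sumrB; under eq_bigr do rewrite -scalerBr.
by apply: norm2_convex_comb => // i; rewrite -pt_dist_nearest//; exact: Xr.
Qed.

Lemma pt_dist_ubound X Y : polytope X -> Y !=set0 ->
  has_ubound [set pt_dist x Y | x in X].
Proof.
move=> /polytope_bounded[M XM] [y Yy]; exists (M + norm2 y) => _ [x Xx <-].
apply: le_trans (pt_dist_le x Yy) (le_trans (norm2D _ _) _).
by rewrite norm2N lerD2r XM.
Qed.

Lemma pt_dist_le_hausdorffl X Y x : polytope X -> Y !=set0 -> X x ->
  pt_dist x Y <= hausdorff_dist X Y.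
Proof.
move=> pX Y0 Xx; rewrite le_max; apply/orP; left.
by apply: ub_le_sup; [exact: pt_dist_ubound|exists x].
Qed.

Lemma pt_dist_le_hausdorffr X Y y : polytope Y -> X !=set0 -> Y y ->
  pt_dist y X <= hausdorff_dist X Y.
Proof.
move=> pY X0 Yy; rewrite le_max; apply/orP; right.
by apply: ub_le_sup; [exact: pt_dist_ubound|exists y].
Qed.

Lemma sup_pt_dist_lt Y (s : seq 'cV[R]_d) r : s != [::] -> polytope Y ->
  (forall x, x \in s -> pt_dist x Y < r) ->
  sup [set pt_dist x Y | x in conv_hull [set` s]] < r.
Proof.
move=> s0 pY sr.
(* A bound that is uniform over [s] keeps the supremum strictly below [r]. *)
have [r' r'r sr'] : exists2 r', r' < r & forall x, x \in s -> pt_dist x Y <= r'.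
  elim: s {s0} sr => [|x s IH] sr; first by exists (r - 1) => //; rewrite gtrBl.
  have [y ys|r' r'r H] := IH; first by apply: sr; rewrite inE ys orbT.
  exists (Num.max r' (pt_dist x Y)).
    by rewrite gt_max r'r sr// mem_head.
  move=> y; rewrite inE => /predU1P[->|/H yr']; rewrite le_max ?lexx ?orbT//.
  by rewrite yr'.
apply: le_lt_trans r'r; apply: ge_sup.
  case: s s0 {sr sr'} => // x s _; exists (pt_dist x Y), x => //.
  by apply: sub_conv_hull; rewrite /= mem_head.
by move=> _ [x xs <-]; exact: pt_dist_conv_hull_le xs.
Qed.

(** In the direction [x - nearest x Y], the nearest point of [z] is not beyond
    that of [x], and [z] is beyond its nearest point by at most the distance
    between them. *)
Lemma farthest_face X Y x : polytope Y -> X x ->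
  (forall z, X z -> pt_dist z Y <= pt_dist x Y) ->
  face X (x - nearest x Y) x.
Proof.
move=> pY Xx far; split=> // z /far; rewrite !pt_dist_nearest// => far_z.
have := nearest_obtuse x pY (nearest_in z pY).
have := le_trans (cauchy_schwarz (x - nearest x Y) (z - nearest z Y))
  (ler_wpM2l (norm2_ge0 _) far_z).
rewrite -expr2 sqr_norm2 !(dotvBr (x - nearest x Y)); lra.
Qed.

(** The segment from [c] to [u] can be prolonged a little beyond [u] inside the
    cone, which is what relative interiors are for. *)
Lemma rel_interior_normal_cone_sub X q u c :
  rel_interior (normal_cone X q) u -> normal_cone X q c ->
  exists2 s, 0 < s & normal_cone X q (u - s *: c).
Proof.
move=> [Nu [e e0 H]] Nc; pose s := e / (norm2 c + 1).
have c1 : 0 < norm2 c + 1 by rewrite ltr_wpDl ?norm2_ge0.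
have s0 : 0 < s by rewrite divr_gt0.
exists s => //; apply: H; last first.
  rewrite addrAC subrr add0r norm2N norm2Z gtr0_norm// /s mulrAC.
  by rewrite ltr_pdivrMr// ltr_pM2l// ltrDl.
(* The apex [0] of the cone brings the sum of the coefficients to [1]. *)
exists 3%N, (fun i : 'I_3 => nth 0 [:: 1; - s; s] i),
  (fun i : 'I_3 => nth 0 [:: u; c; 0] i).
split; rewrite ?big_ord_recr ?big_ord0 /=.
- by case=> [[|[|[|//]]] ?] //= y _; rewrite dot0v.
- by rewrite add0r subrK.
- by rewrite add0r scale1r scaleNr scaler0 addr0.
Qed.

(** The normal cone at a vertex contains a direction [c] exposing this vertex,
    and [u] is the sum of a positive multiple of [c] and of a normal vector. *)
Lemma stable_exposes_vertex X q u : vertex X q ->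
  rel_interior (normal_cone X q) u ->
  forall y, X y -> y != q -> dotv u (y - q) < 0.
Proof.
move=> [c cq] Nu y Xy yq.
have [Xq cmax] : face X c q by rewrite cq.
have Nc : normal_cone X q c.
  by move=> z /cmax; rewrite dotvBr subr_le0.
have [s s0 /(_ y Xy)] := rel_interior_normal_cone_sub Nu Nc.
rewrite dotvBl dotvZl subr_le0 => /le_lt_trans; apply.
rewrite pmulr_rlt0// dotvBr subr_lt0 lt_neqAle cmax// andbT.
apply: contra_neq yq => ycq; suff : face X c y by rewrite cq.
by split=> // z /cmax; rewrite ycq.
Qed.

Lemma segment_cvg (V : normedModType R) (x v : V) :
  (fun t : R => x + t *: v) @ 0^'+ --> x.
Proof.
apply: cvg_at_right_filter.
rewrite -[X in _ --> X]addr0 -[X in _ --> _ + X](scale0r v).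
by apply: cvgD; [exact: cvg_cst|apply: cvgZr_tmp; exact: cvg_id].
Qed.

Lemma pt_dist_le0 X x : polytope X -> pt_dist x X <= 0 -> X x.
Proof.
move=> pX; rewrite pt_dist_nearest// => x0.
suff -> : x = nearest x X by exact: nearest_in.
by apply/eqP; rewrite -subr_eq0 -norm2_eq0 eq_le x0 norm2_ge0.
Qed.

(** If the distance were zero then the two sets would coincide.  The vertex
    would then lie on the boundary, at displacement [0] from its nearest point,
    whereas [0] is relatively interior only to normal cones that are
    linear subspaces. *)
Lemma stable_hausdorff_gt0 X Y q z : polytope X -> polytope Y ->
  vertex Y q -> hausdorff_stable q X -> Y z -> z != q ->
  0 < hausdorff_dist X Y.
Proof.
move=> pX pY qV st Yz zq; rewrite ltNge; apply/negP => XY0.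
have X0 := polytope_nonempty pX; have Y0 := polytope_nonempty pY.
have YX y : Y y -> X y.
  move=> Yy; apply: pt_dist_le0 => //.
  exact: le_trans (pt_dist_le_hausdorffr pY X0 Yy) XY0.
have XY x : X x -> Y x.
  move=> Xx; apply: pt_dist_le0 => //.
  exact: le_trans (pt_dist_le_hausdorffl pX Y0 Xx) XY0.
have XE : X = Y by apply/seteqP; split.
subst Y; have [c cq] := qV; have [Xq cmax] : face X c q by rewrite cq.
case: st => [int|[_]].
  have /(_ _ int) H := @segment_cvg _ q c.
  near (0 : R)^'+ => t.
  have t0 : 0 < t by [].
  have /cmax : X (q + t *: c) by near: t; exact: H.
  rewrite dotvDr dotvZr gerDl pmulr_rle0// => c0.
  have {}c0 : c = 0 by apply/eqP; rewrite -dotv_eq0 eq_le c0 dotv_ge0.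
  have : face X c z by split=> // y _; rewrite c0 !dot0v.
  by rewrite cq => /eqP; rewrite (negbTE zq).
rewrite nearest_id// subrr => /(stable_exposes_vertex qV)/(_ z Yz zq).
by rewrite dot0v ltxx.
Unshelve. all: by end_near. Qed.

End HausdorffDistance.

(** * Vertices and lifts of zonotopes *)

Section ZonotopeVertices.
Variables (R : realType) (d n : nat).
Implicit Types (Q : 'M[R]_(d, n)) (mu u c w : 'cV[R]_d) (x y : 'cV[R]_n).
Implicit Types (b : {ffun 'I_n -> bool}) (J : {set 'I_n}).

Definition cube_vertex b : 'cV[R]_n := \col_j (b j)%:R.

Lemma cube_vertex_in b : unit_cube (cube_vertex b).
Proof. by move=> j; rewrite mxE; case: (b j); rewrite ?lexx ?ler01. Qed.

Lemma zono_map_in Q mu x : unit_cube x -> zonotope Q mu (zono_map Q mu x).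
Proof. by move=> x01; exists x. Qed.

Lemma zono_mapE Q mu x :
  zono_map Q mu x = \sum_j x j 0 *: col j Q + mu.
Proof.
congr (_ + _); apply/colP => i; rewrite mxE summxE.
by apply: eq_bigr => j _; rewrite !mxE mulrC.
Qed.

Lemma dotv_zono_mapB Q mu u x y :
  dotv u (zono_map Q mu x - zono_map Q mu y) =
  \sum_j (x j 0 - y j 0) * dotv u (col j Q).
Proof.
rewrite !zono_mapE opprD addrACA subrr addr0 -sumrB dotv_sumr.
by apply: eq_bigr => j _; rewrite -scalerBl dotvZr.
Qed.

Lemma zono_map_perturb Q mu DQ Dmu t x :
  zono_map (Q + t *: DQ) (mu + t *: Dmu) x =
  zono_map Q mu x + t *: (DQ *m x + Dmu).
Proof. by rewrite /zono_map mulmxDl -scalemxAl scalerDr addrACA. Qed.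

Definition zono_corners Q mu :=
  [seq zono_map Q mu (cube_vertex b) | b <- enum {ffun 'I_n -> bool}].

Lemma zono_cornersP Q mu (z : 'cV[R]_d) :
  reflect (exists b, z = zono_map Q mu (cube_vertex b)) (z \in zono_corners Q mu).
Proof.
apply: (iffP mapP) => [[b _ ->]|[b ->]]; first by exists b.
by exists b; rewrite ?mem_enum.
Qed.

Lemma zonotope_convex Q mu : conv_hull (zonotope Q mu) `<=` zonotope Q mu.
Proof.
move=> z [m [a [v [vZ a0 a1 ->]]]].
have /choice[x xP] i : exists x, unit_cube x /\ zono_map Q mu x = v i.
  by have [x ? ?] := vZ i; exists x.
have sE j : (\sum_i a i *: x i) j 0 = \sum_i a i * x i j 0.
  by rewrite summxE; apply: eq_bigr => i _; rewrite mxE.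
exists (\sum_i a i *: x i).
  move=> j; rewrite sE; apply/andP; split.
    by apply: sumr_ge0 => i _; rewrite mulr_ge0//; have /andP[] := (xP i).1 j.
  rewrite -a1; apply: ler_sum => i _.
  by rewrite ler_piMr//; have /andP[] := (xP i).1 j.
rewrite /zono_map mulmx_sumr -[mu in LHS]scale1r -a1 scaler_suml -big_split /=.
by apply: eq_bigr => i _; rewrite -scalemxAr -scalerDr -(xP i).2.
Qed.

(** Coordinates of a point of the cube are rounded one at a time: [x] lies on
    the segment between its two roundings along a coordinate. *)
Lemma zonotope_hull Q mu : zonotope Q mu = conv_hull [set` zono_corners Q mu].
Proof.
apply/seteqP; split=> [_ [x x01 <-]|]; last first.
  apply: subset_trans (@zonotope_convex Q mu); apply: conv_hull_mono => z /=.
  by move=> /zono_cornersP[b ->]; exact/zono_map_in/cube_vertex_in.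
suff H k y : unit_cube y ->
    (forall j : 'I_n, (k <= j)%N -> y j 0 = 0 \/ y j 0 = 1) ->
    conv_hull [set` zono_corners Q mu] (zono_map Q mu y).
  by apply: (H n) => // j; rewrite leqNgt ltn_ord.
elim: k y => [|k IH] y y01 yb.
  apply: sub_conv_hull => /=; apply/zono_cornersP; exists [ffun j => y j 0 == 1].
  congr zono_map; apply/colP => j; rewrite !mxE ffunE.
  by case: (yb j) => // ->; rewrite ?eqxx// eq_sym oner_eq0.
have [nk|kn] := leqP n k.
  by apply: IH => // j kj; have := leq_trans nk kj; rewrite leqNgt ltn_ord.
pose l := Ordinal kn; pose z r : 'cV[R]_n := \col_j if j == l then r else y j 0.
have zh r : r = 0 \/ r = 1 ->
    conv_hull [set` zono_corners Q mu] (zono_map Q mu (z r)).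
  move=> r01; apply: IH => j; rewrite mxE; case: eqP => //.
    by case: r01 => ->; rewrite ?lexx ?ler01.
  move=> jl kj; apply: yb; rewrite ltn_neqAle kj andbT.
  by apply: contra_notN jl => /eqP kj'; exact: val_inj.
have /andP[l0 l1] := y01 l.
have := convex_segment (@conv_hull_idem _ _ _) (zh 0 (or_introl erefl))
  (zh 1 (or_intror erefl)) l0 l1.
congr (conv_hull _ _); rewrite /zono_map opprD addrACA subrr addr0 -mulmxBr.
rewrite addrAC scalemxAr -mulmxDr; congr (_ *m _ + _).
apply/colP => j; rewrite !mxE; case: eqP => [->|_]; ring.
Qed.

Lemma zono_corners_neq0 Q mu : zono_corners Q mu != [::].
Proof.
have : zono_map Q mu (cube_vertex [ffun=> false]) \in zono_corners Q mu.
  by apply/zono_cornersP; eexists.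
by case: (zono_corners Q mu).
Qed.

Lemma zonotope_polytope Q mu : polytope (zonotope Q mu).
Proof.
apply/polytope_seqP; exists (zono_corners Q mu).
by rewrite zonotope_hull zono_corners_neq0.
Qed.

Lemma free_prescribed_dotv J Q (r : 'I_n -> R) :
  free [seq col j Q | j in J] ->
  exists w, forall j, j \in J -> dotv w (col j Q) = r j.
Proof.
move=> Jf; set X := [seq col j Q | j in J] in Jf.
pose f (v : 'cV[R]_d) := \sum_(k < size X)
  nth 0 [seq r j | j in J] k * coord (in_tuple X) k v.
exists (\col_i f (delta_mx i 0)) => j jJ.
have -> : dotv (\col_i f (delta_mx i 0)) (col j Q) = f (col j Q).
  rewrite [in RHS](matrix_sum_delta (col j Q)) /dotv /f.
  under eq_bigr do rewrite mxE mulr_suml.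
  rewrite exchange_big /=; apply: eq_bigr => k _.
  rewrite linear_sum mulr_sumr; apply: eq_bigr => i _.
  by rewrite big_ord1 linearZ /=; ring.
have jX : (index j (enum J) < size X)%N.
  by rewrite size_image cardE index_mem mem_enum.
have jE : col j Q = (in_tuple X)`_(Ordinal jX).
  by rewrite /= (nth_map j) ?nth_index ?mem_enum// index_mem mem_enum.
rewrite jE /f (bigD1 (Ordinal jX))//= big1 ?addr0 => [|k kj].
  rewrite -[X`__]/((in_tuple X)`_(Ordinal jX)) coord_free// eqxx mulr1.
  by rewrite (nth_map j) ?nth_index ?mem_enum// index_mem mem_enum.
rewrite -[X`__]/((in_tuple X)`_(Ordinal jX)) coord_free// eq_sym.
by rewrite (negbTE kj) mulr0.
Qed.

(** [d] linearly independent generators span the space, so that no nonzero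
    vector is orthogonal to [d] generators. *)
Lemma gp_card_orthogonal Q u : general_position Q -> u != 0 ->
  (#|[set j : 'I_n | dotv u (col j Q) == 0%R]%SET| <= d)%N.
Proof.
move=> gQ u0; rewrite leqNgt; apply/negP => /ltnW/card_geqP[s [us sd sJ]].
pose J := [set j in s]; have Jd : #|J| = d by rewrite cardsE (card_uniqP us).
have Xf := gQ J; rewrite Jd leqnn in Xf; have {}Xf := Xf isT.
set X := [seq col j Q | j in J] in Xf.
have Xfull : <<X>>%VS = fullv.
  apply/eqP; rewrite eqEdim subvf dimvf dim_matrix (eqP Xf) size_image Jd.
  by rewrite mulr1 leqnn.
move: u0; rewrite -dotv_eq0 => /eqP; apply.
have uX : u \in <<in_tuple X>>%VS by rewrite Xfull memvf.
rewrite [X in dotv _ X](coord_span uX) dotv_sumr big1// => k _.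
have /fintype.imageP[j] : (in_tuple X)`_k \in X by rewrite mem_nth.
rewrite inE => /sJ; rewrite inE dotvZr => /eqP ju ->.
by rewrite ju mulr0.
Qed.

Lemma gp_col_neq0 Q j : (0 < d)%N -> general_position Q -> col j Q != 0.
Proof.
move=> d0 /(_ [set j]%SET); rewrite cards1 => /(_ d0).
by rewrite /image_mem enum_set1 seq1_free.
Qed.

Lemma zonotope_other_point Q mu j z : col j Q != 0 ->
  exists2 y, zonotope Q mu y & y != z.
Proof.
move=> Qj; pose y b := zono_map Q mu (cube_vertex b).
have Zy b : zonotope Q mu (y b) by exact/zono_map_in/cube_vertex_in.
have yB : y [ffun i => i == j] - y [ffun=> false] = col j Q.
  rewrite /y !zono_mapE opprD addrACA subrr addr0 -sumrB (bigD1 j)//= big1.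
    by rewrite !mxE !ffunE eqxx scale1r scale0r subr0 addr0.
  by move=> i ij; rewrite !mxE !ffunE (negbTE ij) subrr.
have [yz|] := eqVneq (y [ffun=> false]) z; last by exists (y [ffun=> false]).
by exists (y [ffun i => i == j]); rewrite // -yz -subr_eq0 yB.
Qed.

Definition bsign (a : bool) : R := (-1) ^+ ~~ a.

(** Taking a coordinate away from its value in [b] strictly decreases the linear
    functional [c], whatever the other coordinates are. *)
Lemma signed_exposes Q mu b c :
  (forall j, 0 < bsign (b j) * dotv c (col j Q)) ->
  forall x, unit_cube x ->
  dotv c (zono_map Q mu (cube_vertex b)) <= dotv c (zono_map Q mu x) ->
  x = cube_vertex b.
Proof.
move=> bc x x01 H.
have tE j : (x j 0 - cube_vertex b j 0) * dotv c (col j Q) =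
    - (`|x j 0 - cube_vertex b j 0| * (bsign (b j) * dotv c (col j Q))).
  rewrite mxE /bsign; have /andP[x0 x1] := x01 j; case: (b j) => /=.
    by rewrite ler0_norm ?subr_le0// expr0; ring.
  by rewrite subr0 ger0_norm// expr1; ring.
move: H; rewrite -subr_ge0 -dotvBr dotv_zono_mapB.
under eq_bigr do rewrite tE.
rewrite sumrN oppr_ge0 => H.
have t0 j : 0 <= `|x j 0 - cube_vertex b j 0| * (bsign (b j) * dotv c (col j Q)).
  by rewrite mulr_ge0// ltW.
have /eqP : \sum_j `|x j 0 - cube_vertex b j 0| * (bsign (b j) * dotv c (col j Q)) = 0.
  by apply/eqP; rewrite eq_le H sumr_ge0.
rewrite psumr_eq0// => /allP H0; apply/colP => j; apply/eqP.
have := H0 j (mem_index_enum j).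
by rewrite mulf_eq0 normr_eq0 subr_eq0 (gt_eqF (bc j)) orbF.
Qed.

Lemma signed_vertex Q mu b c :
  (forall j, 0 < bsign (b j) * dotv c (col j Q)) ->
  vertex (zonotope Q mu) (zono_map Q mu (cube_vertex b)).
Proof.
move=> bc; exists c; apply/seteqP; split=> [z [[x x01 <-]]|z ->].
  move=> /(_ _ (zono_map_in Q mu (cube_vertex_in b))) /(signed_exposes bc x01).
  by move=> ->.
split; first exact/zono_map_in/cube_vertex_in.
move=> _ [x x01 <-]; rewrite leNgt; apply/negP => H.
by move: (H); rewrite (signed_exposes bc x01 (ltW H)) ltxx.
Qed.

Lemma signed_lift_pt Q mu b c :
  (forall j, 0 < bsign (b j) * dotv c (col j Q)) ->
  lift_pt Q mu (zono_map Q mu (cube_vertex b)) = cube_vertex b.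
Proof.
move=> bc; have [|x01 xE] := xgetPex 0 (P := [set x | unit_cube x /\
    zono_map Q mu x = zono_map Q mu (cube_vertex b)]).
  by exists (cube_vertex b); split=> //; exact: cube_vertex_in.
by apply: (signed_exposes (mu := mu) bc x01); rewrite xE.
Qed.

Lemma lift_ptP Q mu q : zonotope Q mu q ->
  unit_cube (lift_pt Q mu q) /\ zono_map Q mu (lift_pt Q mu q) = q.
Proof.
case=> x x01 xq.
by apply: (@xgetPex _ 0 [set x | unit_cube x /\ zono_map Q mu x = q]); exists x.
Qed.

(** The generators orthogonal to [u] are linearly independent, hence a small
    perturbation of [u] gives them any prescribed signs; the signs of the
    other generators are determined by [u] itself, as the corner maximizes it. *)
Lemma gp_corner_signed Q mu u b : general_position Q -> u != 0 ->
  face (zonotope Q mu) u (zono_map Q mu (cube_vertex b)) ->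
  exists c, forall j, 0 < bsign (b j) * dotv c (col j Q).
Proof.
move=> gQ u0 [_ umax].
have bu j : 0 <= bsign (b j) * dotv u (col j Q).
  (* [b'] is the corner across the edge of the cube in direction [j]. *)
  pose b' := [ffun i => if i == j then ~~ b j else b i].
  have := umax _ (zono_map_in Q mu (cube_vertex_in b')).
  rewrite -subr_le0 -dotvBr dotv_zono_mapB (bigD1 j)//= big1 => [|i ij].
    rewrite addr0 !mxE ffunE eqxx /bsign; case: (b j) => /=.
      by rewrite sub0r mulN1r oppr_le0 expr0 mul1r.
    by rewrite subr0 mul1r expr1 mulN1r oppr_ge0.
  by rewrite !mxE ffunE (negbTE ij) subrr mul0r.
have [w wJ] := free_prescribed_dotv (fun j => bsign (b j))
  (gQ _ (gp_card_orthogonal gQ u0)).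
have bb j : bsign (b j) * bsign (b j) = 1 by rewrite /bsign -signr_addb addbb.
suff : \forall t \near (0 : R)^'+, forall j,
    0 < bsign (b j) * dotv (u + t *: w) (col j Q).
  by move=> /filter_ex[t H]; exists (u + t *: w).
apply: filter_forall => j; have [uj|uj] := eqVneq (dotv u (col j Q)) 0.
  near=> t; rewrite !dotvE uj add0r wJ ?inE ?uj ?eqxx// mulrCA bb mulr1.
  by [].
have : 0 < bsign (b j) * dotv u (col j Q).
  by rewrite lt_def bu mulf_neq0// /bsign signr_eq0.
have := @segment_cvg R R^o (bsign (b j) * dotv u (col j Q))
  (bsign (b j) * dotv w (col j Q)).
move=> /cvgr_gt H /H; apply: filterS => t.
by rewrite !dotvE mulrDr [_ *: _]mulrCA.
Unshelve. all: by end_near. Qed.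

End ZonotopeVertices.

(** * Topology of the space of zonotopes *)

Section ZonotopeSpace.
Variables (R : realType) (d n : nat).
Implicit Types (Q : 'M[R]_(d, n)) (mu u : 'cV[R]_d).
Implicit Types (X D : 'M[R]_(d, n) * 'cV[R]_d).

Lemma fst_coord_continuous i j : continuous (fun X => X.1 i j).
Proof.
move=> X; apply: (@continuous_comp _ _ _ fst (fun M : 'M[R]_(d, n) => M i j)).
  exact: cvg_fst.
exact: coord_continuous.
Qed.

Lemma snd_coord_continuous i : continuous (fun X => X.2 i 0).
Proof.
move=> X; apply: (@continuous_comp _ _ _ snd (fun v : 'cV[R]_d => v i 0)).
  exact: cvg_snd.
exact: coord_continuous.
Qed.

Lemma zono_map_continuous (e : 'cV[R]_n) i :
  continuous (fun X => zono_map X.1 X.2 e i 0).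
Proof.
rewrite (_ : (fun X => _) = fun X => (0 + \sum_j X.1 i j * e j 0) + X.2 i 0).
  have c1 : continuous (fun X => 0 + \sum_j X.1 i j * e j 0).
    apply: (affine_continuous (f := fun j (Y : 'M[R]_(d, n) * 'cV[R]_d) => Y.1 i j)).
    by move=> j; exact: fst_coord_continuous.
  by move=> X; apply: cvgD; [exact: c1|exact: snd_coord_continuous].
by apply/funext => X; rewrite !mxE add0r.
Qed.

Lemma dotv_col_continuous u j : continuous (fun X => dotv u (col j X.1)).
Proof.
apply: dotv_continuous => i; first by move=> X; exact: cvg_cst.
rewrite (_ : (fun X => _) = fun X => X.1 i j); last by apply/funext => X; rewrite mxE.
exact: fst_coord_continuous.
Qed.

Lemma col_perm_continuous (s : 'S_n) :
  continuous (fun Q : 'M[R]_(d, n) => col_perm s Q).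
Proof.
move=> Q A [B QB BA]; exists (fun i j => B i (s^-1%g j)) => [i j|M MB].
  by have := QB i (s^-1%g j); rewrite mxE permKV.
by apply: BA => i j; rewrite mxE; have := MB i (s j); rewrite permK.
Qed.

(** Zonotopes are orbits of a group acting by homeomorphisms, so that the
    projection onto their space is open. *)
Lemma near_zono_class (A : set (zono_space R d n)) Q mu :
  (\forall X \near (Q, mu), A (zono_class X.1 X.2)) ->
  \forall z \near zono_class Q mu, A z.
Proof.
set B := [set X | A (zono_class X.1 X.2)] => BQ.
have classE X : zono_class X.1 X.2 = (\pi_(zono_space R d n) X)%qT by case: X.
pose U : set (zono_space R d n) :=
  [set z | exists2 X, interior B X & zono_class X.1 X.2 = z].
have invB X Y : zono_class X.1 X.2 = zono_class Y.1 Y.2 ->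
    interior B X -> interior B Y.
  rewrite !classE => E; have /eqmodP := E.
  move=> /existsP[s /andP[/eqP XY1 /eqP XY2]] iB.
  pose g (V : 'M[R]_(d, n) * 'cV[R]_d) := (col_perm s^-1%g V.1, V.2).
  have gY : g Y = X.
    by rewrite /g -XY1 -XY2 -col_permM mulVg col_perm1; case: (X).
  have gB V : B (g V) -> B V.
    rewrite /B /= (_ : zono_class _ _ = zono_class V.1 V.2)//.
    rewrite [RHS]classE; apply/eqmodP/existsP; exists s.
    by rewrite /= -col_permM mulgV col_perm1 !eqxx.
  apply: filterS gB _; have : g @ Y --> g Y.
    apply: (@cvg_pair _ _ _ (nbhs Y) (nbhs (g Y).1) (nbhs (g Y).2) _ _ _
      (fun V => col_perm s^-1%g V.1) snd); last exact: cvg_snd.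
    apply: (@continuous_comp _ _ _ fst (col_perm s^-1%g)); first exact: cvg_fst.
    exact: col_perm_continuous.
  by apply; rewrite gY.
apply: (@filterS _ (nbhs (zono_class Q mu)) _ U).
  by move=> z [X /interior_subset BX <-].
apply: open_nbhs_nbhs; split; last by exists (Q, mu).
rewrite /open /= /quotient_open (_ : _ @^-1` U = interior B).
  exact: open_interior.
apply/seteqP; split=> X.
  by move=> [Y BY YX]; apply: invB BY; rewrite YX classE.
by move=> BX; exists X => //; rewrite classE.
Qed.

Lemma cvg_zono_class Q mu (DQ : 'M[R]_(d, n)) Dmu :
  (fun t : R => zono_class (Q + t *: DQ) (mu + t *: Dmu)) @ 0^'+ --> zono_class Q mu.
Proof.
apply: (@cvg_comp _ _ _ (fun t : R => (Q, mu) + t *: (DQ, Dmu))).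
  exact: segment_cvg.
exact: pi_continuous.
Qed.

End ZonotopeSpace.

(** * First-order variation of the Hausdorff distance *)

Section FirstOrderVariation.
Variables (R : realType) (d n : nat).
Variables (P : set 'cV[R]_d) (Q : 'M[R]_(d, n)) (mu : 'cV[R]_d).
Implicit Types (x y u : 'cV[R]_d) (X D : 'M[R]_(d, n) * 'cV[R]_d).

Local Notation Z := (zonotope Q mu).
Local Notation "'lift'" := (lift_pt Q mu).

(** The derivative at [0] of half the squared distance from [x] to the point of
    the zonotope that follows [y] is the opposite of [gain D x y]. *)
Definition gain D x y : R := dotv (D.1 *m lift y + D.2) (x - y).

Lemma gain_continuous x y : continuous (fun D => gain D x y).
Proof.
apply: dotv_continuous => i; first exact: zono_map_continuous.
by move=> D; exact: cvg_cst.
Qed.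

(** Translating the zonotope away from [x] strictly decreases the gain, so that
    a point where the gain vanishes is not interior to the cone. *)
Lemma interior_improving_cone_gt0 (k : nat) (p q : 'I_k -> 'cV[R]_d) D i :
  interior (improving_cone Q mu p q) D -> p i != q i -> 0 < gain D (p i) (q i).
Proof.
move=> iD pq; have := @segment_cvg _ _ D (0, q i - p i).
move=> /(_ _ iD) H; near (0 : R)^'+ => t.
have t0 : 0 < t by [].
have /(_ i) : improving_cone Q mu p q (D + t *: (0, q i - p i)) by near: t.
rewrite /= scaler0 addr0 addrA -(opprB (p i) (q i)) scalerN dotvBl dotvZl subr_ge0.
by apply: lt_le_trans; rewrite mulr_gt0// dotv_gt0 subr_eq0.
Unshelve. all: by end_near. Qed.

(** A positive gain at every achieving pair brings the finitely many points that
    govern the distance strictly closer: each vertex of [P] and each corner of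
    the zonotope either is nearer than the Hausdorff distance, which persists,
    or belongs to an achieving pair.  Only for a corner does the latter need an
    argument: it is farthest from [P], so that it maximizes a nonzero linear
    functional over the zonotope, which makes it a vertex by general position. *)
Lemma perturb_hausdorff_lt D : polytope P -> general_position Q ->
  0 < hausdorff_dist P Z ->
  (forall x y, achieves_hausdorff P Z x y -> 0 < gain D x y) ->
  \forall t \near 0^'+,
    hausdorff_dist P (zonotope (Q + t *: D.1) (mu + t *: D.2)) < hausdorff_dist P Z.
Proof.
move=> pP gQ; set r := hausdorff_dist P Z => r0 gain_gt0.
have pZ := zonotope_polytope Q mu.
have P0 := polytope_nonempty pP; have Z0 := polytope_nonempty pZ.
have [s [s0 PE sV]] := polytope_vertices pP.
have near_vertices : \forall t \near (0 : R)^'+, forall i : 'I_(size s),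
    pt_dist s`_i (zonotope (Q + t *: D.1) (mu + t *: D.2)) < r.
  apply: filter_forall => i; have si : s`_i \in s by rewrite mem_nth.
  have xV := sV _ si; set x := s`_i in si xV *.
  have Px : P x by rewrite PE; exact: sub_conv_hull.
  set y := nearest x Z; have Zy : Z y := nearest_in x pZ.
  have [y01 yE] := lift_ptP Zy.
  have : norm2 (x - y) < r \/
      norm2 (x - y) = r /\ 0 < dotv (x - y) (D.1 *m lift y + D.2).
    have := pt_dist_le_hausdorffl pP Z0 Px; rewrite pt_dist_nearest// -/y -/r.
    rewrite le_eqVlt => /predU1P[xy|]; [right|by left].
    split=> //; rewrite dotvC; apply: gain_gt0.
    by split=> //; left.
  move=> /(norm2_move_lt r0); apply: filterS => t; apply: le_lt_trans.
  have -> : x - y - t *: (D.1 *m lift y + D.2) =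
      x - zono_map (Q + t *: D.1) (mu + t *: D.2) (lift y).
    by rewrite zono_map_perturb yE opprD addrA.
  exact: pt_dist_le (zono_map_in _ _ y01).
have near_corners : \forall t \near (0 : R)^'+, forall b : {ffun 'I_n -> bool},
    pt_dist (zono_map (Q + t *: D.1) (mu + t *: D.2) (cube_vertex R b)) P < r.
  apply: filter_forall => b; set e := cube_vertex R b; set y := zono_map Q mu e.
  have Zy : Z y by exact/zono_map_in/cube_vertex_in.
  set x := nearest y P; have Px : P x := nearest_in y pP.
  have : norm2 (y - x) < r \/
      norm2 (y - x) = r /\ 0 < dotv (y - x) (- (D.1 *m e + D.2)).
    have := pt_dist_le_hausdorffr pZ P0 Zy; rewrite pt_dist_nearest// -/x -/r.
    rewrite le_eqVlt => /predU1P[xy|]; [right|by left].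
    have yx0 : y - x != 0 by rewrite -norm2_eq0 xy gt_eqF.
    have yface : face Z (y - x) y.
      apply: farthest_face => // z Zz; rewrite [leRHS]pt_dist_nearest// -/x xy.
      exact: pt_dist_le_hausdorffr.
    have [c cb] := gp_corner_signed gQ yx0 yface.
    have := gain_gt0 x y; rewrite /gain (signed_lift_pt mu cb) => H.
    split=> //; rewrite dotvC -opprB dotvNr dotvNl opprK; apply: H.
    split=> //; first by rewrite norm2BC.
    by right; split=> //; exact: signed_vertex cb.
  move=> /(norm2_move_lt r0); apply: filterS => t; apply: le_lt_trans.
  rewrite scalerN opprK addrAC -zono_map_perturb.
  exact: pt_dist_le.
near=> t; rewrite /hausdorff_dist gt_max; apply/andP; split.
  rewrite {1}PE; apply: sup_pt_dist_lt => //; first exact: zonotope_polytope.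
  move=> x xs; have ix : (index x s < size s)%N by rewrite index_mem.
  rewrite -(nth_index 0 xs) -[index x s]/(val (Ordinal ix)).
  by move: (Ordinal ix); near: t.
rewrite {1}zonotope_hull; apply: sup_pt_dist_lt => //; first exact: zono_corners_neq0.
move=> _ /zono_cornersP[b ->]; move: b; near: t.
exact: near_corners.
Unshelve. all: by end_near. Qed.

(** The face of [Z] exposed by [u] is the single point [y], so that each
    coordinate of the lift of [y] is at the end of [0, 1] that the sign of [u]
    on the corresponding generator dictates.  These signs are nonzero, hence
    persist, and [u] still peaks at the same lift on nearby zonotopes. *)
Lemma near_exposed_lift u y : (forall j, col j Q != 0) -> Z y ->
  (forall z, Z z -> z != y -> dotv u (z - y) < 0) ->
  \forall X \near (Q, mu), forall x : 'cV[R]_n, unit_cube x ->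
    dotv u (zono_map X.1 X.2 x) <= dotv u (zono_map X.1 X.2 (lift y)).
Proof.
move=> Q0 Zy yu; have [e01 eE] := lift_ptP Zy; set e := lift y in e01 eE *.
have H j r : 0 <= r <= 1 -> (r - e j 0) * dotv u (col j Q) < 0 \/ r = e j 0.
  move=> r01; have [->|re] := eqVneq r (e j 0); [by right|left].
  pose x : 'cV[R]_n := \col_i if i == j then r else e i 0.
  have xE : zono_map Q mu x - y = (r - e j 0) *: col j Q.
    rewrite -eE !zono_mapE opprD addrACA subrr addr0 -sumrB (bigD1 j)//= big1.
      by rewrite addr0 mxE eqxx -scalerBl.
    by move=> i ij; rewrite mxE (negbTE ij) subrr.
  rewrite -dotvZr -xE; apply: yu.
    by apply: zono_map_in => i; rewrite mxE; case: ifP.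
  by rewrite -subr_eq0 xE scaler_eq0 subr_eq0 (negbTE re) (negbTE (Q0 j)).
suff : \forall X \near (Q, mu), forall j, forall r, 0 <= r <= 1 ->
    (r - e j 0) * dotv u (col j X.1) <= 0.
  apply: filterS => X XH x x01; rewrite -subr_le0 -dotvBr dotv_zono_mapB.
  by apply: sumr_le0 => j _; exact/XH/x01.
apply: (@filter_forall _ _ (fun j X => forall r, 0 <= r <= 1 ->
  (r - e j 0) * dotv u (col j X.1) <= 0) (nbhs (Q, mu)) _) => j.
have c := @dotv_col_continuous R d n u j.
have /andP[e0 e1] := e01 j.
have [uj|uj|uj] := ltgtP (dotv u (col j Q)) 0.
- have ej : e j 0 = 0.
    have [||//] := H j 0; first by rewrite lexx ler01.
    by rewrite sub0r nmulr_llt0// oppr_gt0 ltNge e0.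
  have := near_continuous_lt (s := (Q, mu)) c uj; apply: filterS => X Xj r /andP[r0 _].
  by rewrite ej subr0 mulr_ge0_le0// ltW.
- have ej : e j 0 = 1.
    have [||//] := H j 1; first by rewrite lexx ler01.
    by rewrite pmulr_llt0// subr_lt0 ltNge e1.
  have := near_continuous_gt (s := (Q, mu)) c uj; apply: filterS => X Xj r /andP[_ r1].
  by rewrite ej mulr_le0_ge0 ?subr_le0// ltW.
have [||] := H j 0; rewrite ?lexx ?ler01 ?uj ?mulr0 ?ltxx// => ej0.
have [||] := H j 1; rewrite ?lexx ?ler01 ?uj ?mulr0 ?ltxx// => /eqP.
by rewrite -ej0 oner_eq0.
Qed.

(** The half-space that witnesses the distance between [x] and [y] bounds the
    distance from below on nearby zonotopes: a nonpositive gain means that the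
    image of the lift of [y] does not cross its boundary. *)
Lemma near_hausdorff_ge x y : polytope P -> (forall j, col j Q != 0) ->
  (vertex P x -> hausdorff_stable x Z) -> vertex Z y ->
  achieves_hausdorff P Z x y ->
  \forall X \near (Q, mu), gain (X - (Q, mu)) x y <= 0 ->
    hausdorff_dist P Z <= hausdorff_dist P (zonotope X.1 X.2).
Proof.
move=> pP Q0 st yV [Px Zy <-] xy; have pZ := zonotope_polytope Q mu.
have P0 := polytope_nonempty pP; have [e01 eE] := lift_ptP Zy.
have gainE X : gain (X - (Q, mu)) x y =
    dotv (x - y) (zono_map X.1 X.2 (lift y) - y).
  rewrite dotvC; congr dotv; rewrite -[V in _ = _ - V]eE.
  by rewrite /zono_map mulmxBl opprD addrACA.
case: xy => [[xV yE]|[_ xE]]; last first.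
  near=> X => Xle; rewrite norm2BC.
  apply: le_trans (pt_dist_le_hausdorffr (zonotope_polytope X.1 X.2) P0
    (zono_map_in X.1 X.2 e01)).
  apply: pt_dist_ge_halfspace => // z Pz.
  have := nearest_obtuse y pP Pz; rewrite -xE.
  move: Xle; rewrite gainE -opprB dotvNl !(dotvBr (y - x)); lra.
have Zx z : Z z -> dotv (x - y) (z - y) <= 0 by rewrite yE; exact: nearest_obtuse.
have peak : \forall X \near (Q, mu), forall z : 'cV[R]_n, unit_cube z ->
    dotv (x - y) (zono_map X.1 X.2 z) <= dotv (x - y) (zono_map X.1 X.2 (lift y)).
  case: (st xV) => [/interior_subset Zxx|[_ relx]].
    near=> X => z _; rewrite (_ : x - y = 0) ?dot0v//.
    by rewrite yE nearest_id// subrr.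
  rewrite -yE in relx; apply: near_exposed_lift => // z Zz zy.
  exact: stable_exposes_vertex relx _ Zz zy.
apply: filterS peak => X Xpeak; rewrite gainE => Xle.
have pX := zonotope_polytope X.1 X.2.
apply: le_trans (pt_dist_le_hausdorffl pP (polytope_nonempty pX) Px).
apply: pt_dist_ge_halfspace; first exact: polytope_nonempty.
move=> _ [z z01 <-]; move: Xle (Xpeak z z01); rewrite !(dotvBr (x - y)); lra.
Unshelve. all: by end_near. Qed.

End FirstOrderVariation.

(** * Local minima *)

Unset Implicit Arguments.

Theorem corollary5p5 (R : realType) (d n : nat) (hd : (0 < d)%N) (hn : (0 < n)%N)
  (P : set 'cV[R]_d) (Q : 'M[R]_(d, n)) (mu : 'cV[R]_d)
  (hP : polytope P)
  (hgen : general_position Q)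
  (hstabP : forall v, vertex P v -> hausdorff_stable v (zonotope Q mu))
  (hstabZ : forall v, vertex (zonotope Q mu) v -> hausdorff_stable v P)
  (k : nat) (p q : 'I_k -> 'cV[R]_d)
  (hdistinct : injective (fun i => (p i, q i)))
  (hpairs : forall x y,
     achieves_hausdorff P (zonotope Q mu) x y <-> exists i, p i = x /\ q i = y)
  (hvert : forall i, vertex (zonotope Q mu) (q i)) :
  interior (improving_cone Q mu p q) = set0 <->
  local_min (dist_to P) (zono_class Q mu).
Proof.
have pZ := zonotope_polytope Q mu; have Q0 j := gp_col_neq0 j hd hgen.
have ach i : achieves_hausdorff P (zonotope Q mu) (p i) (q i) by apply/hpairs; exists i.
have distE (X : 'M[R]_(d, n) * 'cV[R]_d) :
    dist_to P (zono_class X.1 X.2) = hausdorff_dist P (zonotope X.1 X.2).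
  by rewrite /dist_to zono_set_class.
split=> [int0|lmin].
  apply: near_zono_class; rewrite (distE (Q, mu)) /=.
  have : \forall X \near (Q, mu), forall i, gain Q mu (X - (Q, mu)) (p i) (q i) <= 0 ->
      hausdorff_dist P (zonotope Q mu) <= hausdorff_dist P (zonotope X.1 X.2).
    apply: (@filter_forall _ _ (fun i X => gain Q mu (X - (Q, mu)) (p i) (q i) <= 0 ->
      hausdorff_dist P (zonotope Q mu) <= hausdorff_dist P (zonotope X.1 X.2))
      (nbhs (Q, mu)) _) => i.
    exact: near_hausdorff_ge hP Q0 (hstabP _) (hvert i) (ach i).
  apply: filterS => X HX; rewrite distE.
  have [[i /HX//]|gain_gt0] :=
    pselect (exists i, gain Q mu (X - (Q, mu)) (p i) (q i) <= 0).
  suff : interior (improving_cone Q mu p q) (X - (Q, mu)) by rewrite int0.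
  have : \forall D \near (X - (Q, mu)), forall i, 0 < gain Q mu D (p i) (q i).
    apply: (@filter_forall _ _ (fun i D => 0 < gain Q mu D (p i) (q i))
      (nbhs (X - (Q, mu))) _) => i.
    have gi : 0 < gain Q mu (X - (Q, mu)) (p i) (q i).
      by rewrite ltNge; apply/negP => gi; apply: gain_gt0; exists i.
    exact: near_continuous_gt (gain_continuous (y := q i)) gi.
  by apply: filterS => D D0 i; exact/ltW/D0.
have dist_gt0 : 0 < hausdorff_dist P (zonotope Q mu).
  have [[|v s] [// _ _ sV]] := polytope_vertices pZ.
  have vV := sV v (mem_head _ _).
  have [z Zz zv] := zonotope_other_point mu v (Q0 (Ordinal hn)).
  exact: stable_hausdorff_gt0 hP pZ vV (hstabZ v vV) Zz zv.
apply/seteqP; split=> // D intD.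
have gain_gt0 x y : achieves_hausdorff P (zonotope Q mu) x y -> 0 < gain Q mu D x y.
  move=> /hpairs[i [<- <-]]; apply: interior_improving_cone_gt0 intD _.
  have [_ _ pq _] := ach i; apply: contraTneq dist_gt0 => piq.
  by rewrite -pq piq subrr norm20 ltxx.
have closer := perturb_hausdorff_lt hP hgen dist_gt0 gain_gt0.
have farther := @cvg_zono_class _ _ _ Q mu D.1 D.2 _ lmin.
have /filter_ex[t []] : \forall t \near (0 : R)^'+,
    hausdorff_dist P (zonotope (Q + t *: D.1) (mu + t *: D.2)) <
      hausdorff_dist P (zonotope Q mu) /\
    dist_to P (zono_class Q mu) <=
      dist_to P (zono_class (Q + t *: D.1) (mu + t *: D.2)).
  exact: filterI closer farther.
by rewrite (distE (Q, mu)) (distE (_, _)) ltNge => /negP.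
Qed.
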